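(* Let $\mathbf{x}_A(T)$ and $\mathbf{y}_A(T)$ be a pair of neighboring trajectories of a dynamical system, with maximal Lyapunov exponent $\lambda$, and let $\epsilon(t)=\|\mathbf{x}_A(t)-\mathbf{y}_A(t)\|$ for times $t\ge0$, $t\in T$. Suppose $$\beta_{\mathrm{exp}}=-\lim_{t\to\infty}\lim_{\epsilon(0)\to0}\frac{1}{\epsilon(t)}\ln\left(\frac{\beta_0^{\epsilon(t)}(\mathbf{x}_A(T)\cup\mathbf{y}_A(T))}{\beta_0^{\epsilon(0)}(\mathbf{x}_A(T)\cup\mathbf{y}_A(T))}\right),$$ where $\beta_0^{\epsilon(t)}=\dim\big(H_0(\mathcal{R}_{\epsilon(t)}(\mathbf{x}_A(T)\cup\mathbf{y}_A(T)))\big)$. Then $\lambda>0$ implies $\beta_{\mathrm{exp}}\ge0$.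
   Context: A dynamical system is a system modeled by $p$ differential equations for functions $X_1(A,t),\dots,X_p(A,t)$ of time $t$ and control parameters $A$. A trajectory evaluated at the set of times $T$ is $\mathbf{x}_A(T)=\{\mathbf{x}_A(t):t\in T\}\subset\mathbb{R}^p$ with $\mathbf{x}_A(t)=(X_1(A,t),\dots,X_p(A,t))$; $\mathbf{y}_A(T)$ is a neighboring trajectory of $\mathbf{x}_A(T)$ if their initial points (at time $0$) are within distance $\epsilon$ for an $\epsilon>0$. The limit $t\to\infty$ is over times in $T$, and the limit $\epsilon(0)\to0$ is over neighboring trajectories whose initial separation tends to $0$. The maximal Lyapunov exponent is $\lambda=\lim_{t\to\infty}\lim_{\epsilon(0)\to0}\frac1t\ln\left(\frac{\epsilon(t)}{\epsilon(0)}\right)$. For a point cloud $Z$, $\mathcal{R}_\epsilon(Z)=\{\sigma\subset Z:\|\mathbf{z}_i-\mathbf{z}_j\|\le2\epsilon\ \forall\,\mathbf{z}_i,\mathbf{z}_j\in\sigma\}$ is the Vietoris-Rips complex at radius $\epsilon$, and $H_0$ is 0-dimensional homology (with field coefficients). *)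

(* Defs.v *)
From HB Require Import structures.
From mathcomp Require Import all_boot all_order all_algebra ring_quotient.
From mathcomp Require Import finmap.
From mathcomp Require Import all_classical all_reals all_analysis.
From mathcomp.multinomials Require Import freeg.

Set Implicit Arguments.
Unset Strict Implicit.
Unset Printing Implicit Defensive.

Import Order.TTheory GRing.Theory Num.Theory.
Import numFieldNormedType.Exports.

Local Open Scope classical_set_scope.
Local Open Scope ring_scope.
Local Open Scope quotient_scope.

Section Dimension.
Variables (F : fieldType) (V : lmodType F).

Definition lin_indep (n : nat) (v : 'I_n -> V) : Prop :=
  forall a : 'I_n -> F, \sum_i a i *: v i = 0 -> forall i, a i = 0.

(* [V] may be infinite dimensional, and then [vdim R V = +oo]. *)
Definition vdim (R : realType) : \bar R :=
  ereal_sup [set n%:R%:E | n in [set n : nat | exists v : 'I_n -> V, lin_indep v]].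

End Dimension.

Section Cokernel.
Variables (F : fieldType) (U V : lmodType F) (f : {linear U -> V}).

Definition limage : {pred V} := [pred v | `[< exists u : U, f u = v >]].

Lemma limage_submod_closed : submod_closed limage.
Proof.
split=> [|a v w]; first by apply/asboolP; exists 0; rewrite linear0.
move=> /asboolP[u <-] /asboolP[u' <-]; apply/asboolP.
by exists (a *: u + u'); rewrite linearP.
Qed.

HB.instance Definition _ := GRing.isSubmodClosed.Build F V limage limage_submod_closed.

Definition coker : Type := ring_quotient.Quotient.quot limage.

HB.instance Definition _ := GRing.Zmodule.on coker.
HB.instance Definition _ := generic_quotient.Quotient.on coker.

Definition coker_scale (a : F) (x : coker) : coker := \pi_coker (a *: repr x).

Lemma pi_cokerP (v w : V) : reflect (\pi_coker v = \pi_coker w) (v - w \in limage).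
Proof. by rewrite ring_quotient.Quotient.idealrBE; exact: eqP. Qed.

Lemma pi_coker_scale a v : coker_scale a (\pi v) = \pi_coker (a *: v).
Proof.
apply/pi_cokerP; rewrite -scalerBr rpredZ//; apply/pi_cokerP.
exact: reprK.
Qed.

Lemma pi_cokerD : {morph \pi_coker : v w / v + w}.
Proof. exact: (@ring_quotient.Quotient.pi_add V limage). Qed.

Lemma coker_scaleA a b x : coker_scale a (coker_scale b x) = coker_scale (a * b) x.
Proof. by rewrite -[x]reprK !pi_coker_scale scalerA. Qed.

Lemma coker_scale1 : left_id 1 coker_scale.
Proof. by move=> x; rewrite -[x]reprK pi_coker_scale scale1r. Qed.

Lemma coker_scaleDr : right_distributive coker_scale +%R.
Proof.
move=> a x y; rewrite -[x]reprK -[y]reprK -pi_cokerD !pi_coker_scale.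
by rewrite scalerDr pi_cokerD.
Qed.

Lemma coker_scaleDl x : {morph coker_scale^~ x : a b / a + b}.
Proof.
by move=> a b; rewrite -[x]reprK !pi_coker_scale scalerDl pi_cokerD.
Qed.

HB.instance Definition _ := GRing.Zmodule_isLmodule.Build F coker
  coker_scaleA coker_scale1 coker_scaleDr coker_scaleDl.

End Cokernel.

Section FreeLift.
Variables (F : fieldType) (K : choiceType) (M : lmodType F) (f : K -> M).
Local Notation lift := (fglift f : {freeg K / F} -> M).

Lemma fglift_zmod_morphism : zmod_morphism lift.
Proof. exact: lift_is_additive. Qed.

HB.instance Definition _ :=
  GRing.isZmodMorphism.Build {freeg K / F} M (fglift f) fglift_zmod_morphism.

Lemma fglift_scalable : scalable lift.
Proof.
move=> a D; rewrite [a *: D]/(fgscale a D) -{3}[D]freeg_sumE !raddf_sum.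
apply: eq_bigr => z _ /=.
by rewrite !liftU scalerA.
Qed.

HB.instance Definition _ :=
  GRing.isScalable.Build F {freeg K / F} M *:%R (fglift f) fglift_scalable.

End FreeLift.

Section ZerothHomology.
Variables (F : fieldType) (V : choiceType) (K : set {fset V}).
Local Open Scope fset_scope.

(* [K] is meant to be an abstract simplicial complex, given by its simplices. *)
Definition vertices : set V := [set v | K [fset v]].

(* The ordered 1-simplices (u, v). The degenerate ones, u = v, have boundary 0
   and (v, u) has the boundary of -(u, v), so the image of [boundary1] is that
   of the boundary of oriented 1-simplices. *)
Definition edges : set (vertices * vertices) :=
  [set e | K [fset val e.1; val e.2]].

Definition chains0 := {freeg vertices / F}.
Definition chains1 := {freeg edges / F}.

Definition boundary1 : {linear chains1 -> chains0} :=
  fglift (fun e : edges => << (val e).2 >> - << (val e).1 >> : chains0).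

Definition H0 : lmodType F := coker boundary1.

End ZerothHomology.

Section Euclidean.
Variables (R : realType) (p : nat).

(* The library norm on ['rV[R]_p] is the maximum norm. *)
Definition enorm (v : 'rV[R]_p) : R := Num.sqrt (\sum_i v ord0 i ^+ 2).

Definition vietoris_rips (eps : R) (Z : set 'rV[R]_p) : set {fset 'rV[R]_p} :=
  [set s | [/\ s != fset0,
              (forall u, u \in s -> Z u) &
              (forall u v, u \in s -> v \in s -> enorm (u - v) <= 2 * eps)]].

Definition betti0 (F : fieldType) (eps : R) (Z : set 'rV[R]_p) : \bar R :=
  vdim (H0 F (vietoris_rips eps Z)) R.

End Euclidean.

Section Dynamics.
Variables (R : realType) (P : Type) (p : nat).

(* [p] ordinary differential equations of order [ds_order], in the implicit form
   [ds_eq i A t (X(t), X'(t), ...) = 0]; explicit first-order systems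
   [X' = G (A, t, X)] are the case [ds_order = 1] and
   [ds_eq i A t j = j 1 0 i - G (A, t, j 0) 0 i]. *)
Record dynamical_system := DynamicalSystem {
  ds_order : nat;
  ds_eq : 'I_p -> P -> R -> ('I_ds_order.+1 -> 'rV[R]_p) -> R
}.

Variables (S : dynamical_system) (A : P) (J T : set R).

(* Solutions on the time interval [J]; end points of [J] only carry continuity. *)
Definition is_trajectory (x : R -> 'rV[R]_p) : Prop :=
  (forall i, {within J, continuous (fun t => x t ord0 i)}) /\
  forall t, interior J t ->
    (forall i (k : nat), (k < ds_order S)%N ->
       derivable ((fun s => x s ord0 i)^`(k))%classic t 1) /\
    (forall i, ds_eq i A t
       (fun k : 'I_(ds_order S).+1 => \row_j ((fun s => x s ord0 j)^`(k))%classic t) = 0).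

Definition separation (x y : R -> 'rV[R]_p) (t : R) : R := enorm (x t - y t).

Definition neighboring (r : R) (x y : R -> 'rV[R]_p) : Prop :=
  separation x y 0 <= r.

(* Filter of the limit [separation x y 0 -> 0], over the neighboring
   trajectories [y] of [x]. *)
Definition initial_separation_to0 (r : R) (x : R -> 'rV[R]_p) :
    set_system (R -> 'rV[R]_p) :=
  filter_from [set d : R | 0 < d]
    (fun d => [set y | [/\ is_trajectory y, neighboring r x y &
                           0 < separation x y 0 < d]]).

(* [l] is the limit, as t -> +oo in [T], of the limits as [separation x y 0]
   tends to 0 of [q t y]. The inner limits need only exist for large [t], and
   may be infinite. *)
Definition is_iterated_lim (r : R) (x : R -> 'rV[R]_p)
    (q : R -> (R -> 'rV[R]_p) -> \bar R) (l : \bar R) : Prop :=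
  exists2 g : R -> \bar R,
    (\forall t \near within T +oo%R,
      q t @ initial_separation_to0 r x --> g t) &
    g t @[t --> within T +oo%R] --> l.

Definition is_max_lyapunov (r : R) (x : R -> 'rV[R]_p) (l : \bar R) : Prop :=
  is_iterated_lim r x
    (fun t y => t^-1%:E * lne (separation x y t / separation x y 0)%:E)%E l.

Definition traj_union (x y : R -> 'rV[R]_p) : set 'rV[R]_p :=
  (x @` T) `|` (y @` T).

(* Quotients of Betti numbers follow the conventions of [\bar R]: dividing by
   [+oo] gives [0]. This is the expected value unless both numbers are infinite,
   in which case the quotient has no meaning. *)
Definition is_beta_exp (F : fieldType) (r : R) (x : R -> 'rV[R]_p)
    (b : \bar R) : Prop :=
  exists2 l : \bar R,
    is_iterated_lim r x
      (fun t y => (separation x y t)^-1%:E *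
         lne (betti0 F (separation x y t) (traj_union x y) /
              betti0 F (separation x y 0) (traj_union x y)))%E l &
    b = (- l)%E.

End Dynamics.

(* Main.v *)
Require Import Defs.
From HB Require Import structures.
From mathcomp Require Import all_boot all_order all_algebra.
From mathcomp Require Import finmap.
From mathcomp Require Import all_classical all_reals all_analysis.
From mathcomp.multinomials Require Import freeg.

Set Implicit Arguments.
Unset Strict Implicit.
Unset Printing Implicit Defensive.

Import Order.TTheory GRing.Theory Num.Theory.
Import numFieldNormedType.Exports.

Local Open Scope classical_set_scope.
Local Open Scope ring_scope.

(** A positive exponent forces nearby trajectories apart: for large [t], the
    inner limit of [t^-1 * ln (eps t / eps 0)] is positive, so
    [eps 0 < eps t] for every trajectory that starts close enough to [x].
    Enlarging the radius of a Vietoris-Rips complex keeps its vertices, namely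
    all points of the cloud, and only adds simplices; hence components can only
    merge and the zeroth Betti number can only decrease ([betti0_le]).  So the
    quotient of Betti numbers at [eps t] and [eps 0] is at most [1], its scaled
    logarithm is at most [0], and this bound passes to both limits
    ([iterated_lim_le0]).  The opposite of the limit is thus nonnegative.

    The decrease of the Betti number is linear algebra: the inclusion of
    complexes induces a surjection of 0-chains that maps boundaries to
    boundaries, and a family of independent classes of the larger complex lifts
    along it ([coker_vdim_le]).  The dimensions may be infinite: a quotient by
    [+oo] is [0], whose logarithm [-oo] still satisfies the bound
    ([dive_le1]). *)

Section FreeModules.
Variables (F : fieldType) (K : choiceType).

Lemma freeg_scaleU (a : F) (k : K) : a *: << k >> = << a *g k >>.
Proof.
by apply/eqP/freeg_eqP => z; rewrite coeff_fgscale !coeffU mul1r.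
Qed.

Lemma freeg_sum_gens (D : {freeg K / F}) :
  D = \sum_(k <- dom D) coeff k D *: << k >>.
Proof.
by rewrite -[LHS]freeg_sumE; apply: eq_bigr => k _; rewrite freeg_scaleU.
Qed.

Lemma fglift_gen (M : lmodType F) (f : K -> M) (k : K) : fglift f << k >> = f k.
Proof. by rewrite liftU scale1r. Qed.

End FreeModules.

Section Cokernel.
Variables (F : fieldType) (U V : lmodType F) (f : {linear U -> V}).

Definition coker_proj (v : V) : coker f := \pi_(coker f)%qT v.

Lemma coker_proj_linear : linear coker_proj.
Proof. by move=> a v w; rewrite /coker_proj pi_cokerD -pi_coker_scale. Qed.

HB.instance Definition _ :=
  GRing.isLinear.Build F V (coker f) *:%R coker_proj coker_proj_linear.

Lemma coker_proj_eq0 (v : V) : coker_proj v = 0 <-> v \in limage f.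
Proof.
rewrite -[0](raddf0 coker_proj).
by split=> [/pi_cokerP|v_im]; [|apply/pi_cokerP]; rewrite subr0.
Qed.

Lemma coker_projK (c : coker f) : coker_proj (repr c) = c.
Proof. exact: reprK. Qed.

End Cokernel.

Section Dimension.
Variables (F : fieldType) (R : realType).

Lemma vdim_ge0 (V : lmodType F) : (0 <= vdim V R)%E.
Proof.
apply: ereal_sup_ubound; exists 0%N => //=.
by exists (fun=> 0) => a _ [].
Qed.

(** A linear relation between lifts of classes says that a combination of lifts
    lies in the image of [f1]; applying [phi] turns it into the same relation
    between the original classes.  Working with one finite family at a
    time covers infinite dimensions as well. *)
Lemma coker_vdim_le (U1 U2 V1 V2 : lmodType F)
    (f1 : {linear U1 -> V1}) (f2 : {linear U2 -> V2}) (phi : {linear V1 -> V2}) :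
  (forall u, phi (f1 u) \in limage f2) -> (forall v2, exists v1, phi v1 = v2) ->
  (vdim (coker f2) R <= vdim (coker f1) R)%E.
Proof.
move=> phif phi_surj; apply: le_ereal_sup => _ [n [c c_free] <-].
exists n => //=.
have /choice[w phiw] (i : 'I_n) : exists w, phi w = repr (c i) by exact: phi_surj.
exists (fun i => coker_proj f1 (w i)) => a aw0; apply: c_free.
have /coker_proj_eq0/asboolP[u fu] : coker_proj f1 (\sum_i a i *: w i) = 0.
  by rewrite linear_sum -[RHS]aw0; apply: eq_bigr => i _; rewrite linearZ.
under eq_bigr do rewrite -[c _]coker_projK -phiw -linearZ -[_ *: phi _]linearZ.
by rewrite -!linear_sum -fu; apply/coker_proj_eq0.
Qed.

End Dimension.

Section Homology.
Variables (F : fieldType) (R : realType) (V : choiceType).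
Variables (K1 K2 : set {fset V}).
Hypotheses (K12 : K1 `<=` K2) (K21 : vertices K2 `<=` vertices K1).

Lemma vertices_sub : vertices K1 `<=` vertices K2.
Proof. by move=> v; exact: K12. Qed.

Definition vertex_incl (v : vertices K1) : vertices K2 :=
  SigSub (mem_set (vertices_sub (set_mem (valP v)))).

(** The hypothesis on vertices is essential: a new vertex could add a new
    component, and the map on 0-chains would no longer be onto. *)
Lemma H0_vdim_le : (vdim (H0 F K2) R <= vdim (H0 F K1) R)%E.
Proof.
pose phi : {linear chains0 F K1 -> chains0 F K2} :=
  fglift (fun v => << vertex_incl v >> : chains0 F K2).
apply: (@coker_vdim_le _ _ _ _ _ _ _ _ phi) => [u|D].
  rewrite [u]freeg_sum_gens !linear_sum rpred_sum// => e _.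
  rewrite !linearZ rpredZ//= fglift_gen linearB/= !fglift_gen.
  have e_edge : edges (K:=K2) (vertex_incl (val e).1, vertex_incl (val e).2).
    by apply: K12; exact: set_mem (valP e).
  apply/asboolP; exists << (SigSub (mem_set e_edge) : edges (K:=K2)) >>.
  exact: fglift_gen.
(* Surjectivity: lift a 0-chain generator by generator. *)
have /choice[g gK] (v : vertices K2) : exists u, vertex_incl u = v.
  exists (SigSub (mem_set (K21 (set_mem (valP v))))); exact: val_inj.
exists (fglift (fun v => << g v >> : chains0 F K1) D).
rewrite [D in LHS]freeg_sum_gens [RHS]freeg_sum_gens !linear_sum.
by apply: eq_bigr => v _; rewrite !linearZ/= !fglift_gen gK.
Qed.

End Homology.

Section Euclidean.
Variables (F : fieldType) (R : realType) (p : nat).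

(** Nonnegativity of the smaller radius ensures that every point of [Z] is
    already a vertex at that radius; at a negative radius the complex is
    empty. *)
Lemma betti0_le (Z : set 'rV[R]_p) (e1 e2 : R) : 0 <= e1 -> e1 <= e2 ->
  (betti0 F e2 Z <= betti0 F e1 Z)%E.
Proof.
move=> e1_ge0 e12; apply: H0_vdim_le => [s [s0 sZ sd]|v [_ vZ _]].
  by split=> // u v us vs; rewrite (le_trans (sd _ _ us vs))// ler_pM2l.
split=> [||u w /fset1P-> /fset1P->]; first by apply/fset0Pn; exists v; rewrite fset11.
  exact: vZ.
rewrite subrr /enorm big1 ?sqrtr0 ?mulr_ge0// => i _.
by rewrite mxE expr0n.
Qed.

End Euclidean.

Section LogQuotient.
Variable R : realType.
Local Open Scope ereal_scope.

(** The degenerate quotients [0 / 0] and [+oo / +oo] are both [0] in the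
    extended reals, so they too are at most [1]. *)
Lemma dive_le1 (a b : \bar R) : 0 <= a -> a <= b -> a / b <= 1.
Proof.
move=> a_ge0; case: b => [b||] ab; last 2 first.
- by rewrite invey mule0.
- by move: (le_trans a_ge0 ab); rewrite leeNy_eq.
have b_ge0 := le_trans a_ge0 ab.
have [b0|b_neq0] := eqVneq b 0%R.
  have -> : a = 0 by apply/le_anti; rewrite a_ge0 andbT (le_trans ab)// b0.
  by rewrite mul0e.
have b_gt0 : (0 < b)%R by rewrite lt_neqAle eq_sym b_neq0 -lee_fin.
by rewrite inver (negbTE b_neq0) lee_pdivrMr// mul1e.
Qed.

End LogQuotient.

Section Limits.
Variables (R : realType) (P : Type) (p : nat).
Variables (S : dynamical_system R P p) (A : P) (J T : set R).
Variables (r : R) (x : R -> 'rV[R]_p).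

Hypothesis T_unbounded : forall M : R, exists2 t, T t & M < t.
Hypothesis neighbors : forall d : R, 0 < d -> exists y,
  [/\ is_trajectory S A J y, neighboring r x y & 0 < separation x y 0 < d].

Local Notation sep0 := (initial_separation_to0 S A J r x).

Lemma initial_separation_proper : ProperFilter sep0.
Proof.
apply: filter_from_proper => [|d /neighbors[y y_nbr]]; last by exists y.
apply: filter_from_filter => [|d e d0 e0]; first by exists 1 => /=.
exists (Num.min d e) => [|y [y_traj y_nbr /andP[y0]]].
  by rewrite /= lt_min; apply/andP.
by rewrite lt_min => /andP[yd ye]; split; split; rewrite ?y0.
Qed.

Lemma within_pinfty_proper : ProperFilter (within T +oo%R).
Proof.
apply: Build_ProperFilter_ex => B [M [_ MB]].
by have [t Tt Mt] := T_unbounded M; exists t; exact: MB.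
Qed.

(** Positivity is an open condition, so it descends from the outer limit to the
    inner ones and then to the quantities themselves, eventually; the sign
    [<= 0] is a closed condition, so it climbs back up through the limits of
    [q2].  Both filters are proper, which prevents these eventual statements
    from being vacuous. *)
Lemma iterated_lim_le0 (q1 q2 : R -> (R -> 'rV[R]_p) -> \bar R) (l1 l2 : \bar R) :
  is_iterated_lim S A J T r x q1 l1 -> is_iterated_lim S A J T r x q2 l2 ->
  (forall t y, 0 < t -> 0 < separation x y 0 -> (0 < q1 t y)%E -> (q2 t y <= 0)%E) ->
  (0 < l1)%E -> (l2 <= 0)%E.
Proof.
have ? := initial_separation_proper; have ? := within_pinfty_proper.
move=> [g1 q1g1 g1l1] [g2 q2g2 g2l2] q12 l1_gt0.
apply: cvge_le g2l2.
have g1_gt0 : \forall t \near within T +oo%R, (0 < g1 t)%E.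
  exact: g1l1 (open_ereal_gt' l1_gt0).
have t_gt0 : \forall t \near within T +oo%R, 0 < t.
  by apply: cvg_within; exact: nbhs_pinfty_gt.
near=> t.
have g1t_gt0 : (0 < g1 t)%E by near: t.
have t0 : 0 < t by near: t.
have q1t_gt0 : \forall y \near sep0, (0 < q1 t y)%E.
  have : q1 t @ sep0 --> g1 t by near: t.
  by move/(_ _ (open_ereal_gt' g1t_gt0)).
have q2g2t : q2 t @ sep0 --> g2 t by near: t.
apply: cvge_le q2g2t.
have y_gt0 : \forall y \near sep0, 0 < separation x y 0.
  by exists 1 => //= y [_ _ /andP[]].
near=> y.
by apply: q12; [|near: y|near: y].
Unshelve. all: by end_near. Qed.

End Limits.

Theorem theorem21 (R : realType) (F : fieldType) (P : Type) (p : nat)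
  (S : dynamical_system R P p) (A : P) (J T : set R)
  (x : R -> 'rV[R]_p) (r : R) (lambda beta_exp : \bar R)
  (J_itv : is_interval J) (J_ge0 : [set t : R | 0 <= t] `<=` J)
  (T_sub : T `<=` J)
  (T_unbounded : forall M : R, exists2 t, T t & M < t)
  (r_gt0 : 0 < r)
  (x_traj : is_trajectory S A J x)
  (neighbors : forall d : R, 0 < d -> exists y, [/\ is_trajectory S A J y,
     neighboring r x y & 0 < separation x y 0 < d])
  (lambda_def : is_max_lyapunov S A J T r x lambda)
  (beta_def : is_beta_exp S A J T F r x beta_exp) :
  (0 < lambda)%E -> (0 <= beta_exp)%E.
Proof.
move=> lambda_gt0; have [l l_lim ->] := beta_def; rewrite oppe_ge0.
apply: (iterated_lim_le0 T_unbounded neighbors lambda_def l_lim) lambda_gt0.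
move=> t y t_gt0 sep0_gt0.
rewrite pmule_rgt0 ?lte_fin ?invr_gt0// lne_gt0 lte_fin ltr_pdivlMr// mul1r => sep_lt.
rewrite pmule_rle0 ?lte_fin ?invr_gt0 ?(lt_trans sep0_gt0)// lne_le0.
by apply: dive_le1; [exact: vdim_ge0|exact/betti0_le/ltW/sep_lt/ltW].
Qed.
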